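(* The unital $*$-algebra $\widehat{\mathcal B}$ (defined in the context), equipped with the coproduct $\widehat\Delta:\widehat{\mathcal B}\to\widehat{\mathcal B}\otimes\widehat{\mathcal B}$ and the counit $\widehat\epsilon:\widehat{\mathcal B}\to\mathbb C$ given on generators by $$\widehat\Delta(X_k(\sigma))=X_k(\sigma)\otimes P(\sigma)+P(\sigma)\otimes X_k(\sigma),\qquad \widehat\Delta(P(\sigma))=P(\sigma)\otimes P(\sigma),$$ $$\widehat\epsilon(X_k(\sigma))=0,\qquad \widehat\epsilon(P(\sigma))=1,$$ for all $k\in\mathbb N$ and $\sigma\in\mathcal P(\mathbb N)$ (extended as unital $*$-homomorphisms), is a unital $*$-bialgebra.
   Context: $\mathbb N=\{1,2,\dots\}$ and $\mathcal P(\mathbb N)$ is its power set. $\widehat{\mathcal B}$ is the unital $*$-algebra over $\mathbb C$ generated by noncommuting elements $X_k(\sigma)$, $P(\sigma)$, $k\in\mathbb N$, $\sigma\in\mathcal P(\mathbb N)$, with involution determined by $X_k(\sigma)^*=X_k(\sigma)$, $P(\sigma)^*=P(\sigma)$, subject to the relations $$P(\sigma)P(\tau)=P(\sigma\cap\tau),\qquad P(\mathbb N)=1,\qquad P(\sigma)X_k(\tau)=X_k(\tau)P(\sigma)\ \text{ whenever } k\in\sigma .$$ A unital $*$-bialgebra is a unital $*$-algebra with a coassociative coproduct and a counit that are both well-defined unital $*$-homomorphisms and satisfy the counit axiom. *)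

(* Defs.v *)
From HB Require Import structures.
From mathcomp Require Import all_boot all_order all_algebra.
From mathcomp Require Import generic_quotient.
From mathcomp Require Import boolp classical_sets.

Set Implicit Arguments.
Unset Strict Implicit.
Unset Printing Implicit Defensive.

Import Order.TTheory GRing.Theory Num.Theory.

Local Open Scope quotient_scope.
Local Open Scope ring_scope.

(******************************************************************************)
(*                          Unital star-algebras                              *)
(******************************************************************************)

HB.mixin Record isStarAlgebra (C : numClosedFieldType) A
    of GRing.Algebra C A := {
  star : A -> A;
  starK : involutive star;
  starD : forall a b : A, star (a + b) = star a + star b;
  starZ : forall (c : C) (a : A), star (c *: a) = c^* *: star a;
  starM : forall a b : A, star (a * b) = star b * star a
}.

#[short(type="starAlgType")]
HB.structure Definition StarAlgebra (C : numClosedFieldType) :=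
  {A of GRing.Algebra C A & isStarAlgebra C A}.

Section ScalarStarAlgebra.
Variable C : numClosedFieldType.

Let conj_starZ (c : C) (a : C^o) :
  Num.conj (c *: a : C^o) = c^* *: (Num.conj a : C^o).
Proof. exact: rmorphM. Qed.

Let conj_starM (a b : C^o) : (a * b)^* = b^* * a^*.
Proof. by rewrite rmorphM mulrC. Qed.

HB.instance Definition _ := isStarAlgebra.Build C C^o
  (@conjCK C) (@rmorphD _ _ (@Num.conj C)) conj_starZ conj_starM.

End ScalarStarAlgebra.

HB.mixin Record isStarPreserving (C : numClosedFieldType)
    (A B : starAlgType C) (f : A -> B) := {
  star_morph : forall a : A, f (star a) = star (f a)
}.

#[short(type="starHom")]
HB.structure Definition StarHom (C : numClosedFieldType)
    (A B : starAlgType C) :=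
  {f of @GRing.LRMorphism C A B *:%R f & isStarPreserving C A B f}.

(******************************************************************************)
(*     Star-algebras presented by generators G and relations rel              *)
(*                                                                            *)
(* Formal star-algebra expressions in the generators, modulo the smallest     *)
(* congruence that contains rel and the axioms of unital star-algebras.       *)
(* Opposites are encoded as scaling by -1.                                    *)
(* A presented star-algebra may be zero, which algType excludes: the          *)
(* algType structure is only declared on instances shown to be nonzero.       *)
(******************************************************************************)

Section Presentation.
Variables (C : numClosedFieldType) (G : Type).

Inductive sexpr : Type :=
  | SGen of G
  | SZero
  | SOne
  | SAdd of sexpr & sexpr
  | SMul of sexpr & sexpr
  | SScale of C & sexpr
  | SStar of sexpr.

HB.instance Definition _ := gen_eqMixin sexpr.
HB.instance Definition _ := gen_choiceMixin sexpr.

Variable rel : sexpr -> sexpr -> Prop.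

Inductive scong : sexpr -> sexpr -> Prop :=
  | scong_rel a b : rel a b -> scong a b
  | scong_refl a : scong a a
  | scong_sym a b : scong a b -> scong b a
  | scong_trans b a d : scong a b -> scong b d -> scong a d
  | scong_add a a' b b' :
      scong a a' -> scong b b' -> scong (SAdd a b) (SAdd a' b')
  | scong_mul a a' b b' :
      scong a a' -> scong b b' -> scong (SMul a b) (SMul a' b')
  | scong_scale c a a' : scong a a' -> scong (SScale c a) (SScale c a')
  | scong_star a a' : scong a a' -> scong (SStar a) (SStar a')
  | scong_addA a b d : scong (SAdd a (SAdd b d)) (SAdd (SAdd a b) d)
  | scong_addC a b : scong (SAdd a b) (SAdd b a)
  | scong_add0 a : scong (SAdd SZero a) a
  | scong_addN a : scong (SAdd (SScale (-1) a) a) SZero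
  | scong_scaleA c d a : scong (SScale c (SScale d a)) (SScale (c * d) a)
  | scong_scale1 a : scong (SScale 1 a) a
  | scong_scaleDr c a b :
      scong (SScale c (SAdd a b)) (SAdd (SScale c a) (SScale c b))
  | scong_scaleDl c d a :
      scong (SScale (c + d) a) (SAdd (SScale c a) (SScale d a))
  | scong_mulA a b d : scong (SMul a (SMul b d)) (SMul (SMul a b) d)
  | scong_mul1l a : scong (SMul SOne a) a
  | scong_mul1r a : scong (SMul a SOne) a
  | scong_mulDl a b d :
      scong (SMul (SAdd a b) d) (SAdd (SMul a d) (SMul b d))
  | scong_mulDr a b d :
      scong (SMul a (SAdd b d)) (SAdd (SMul a b) (SMul a d))
  | scong_scaleAl c a b : scong (SScale c (SMul a b)) (SMul (SScale c a) b)
  | scong_scaleAr c a b : scong (SScale c (SMul a b)) (SMul a (SScale c b))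
  | scong_starK a : scong (SStar (SStar a)) a
  | scong_starD a b : scong (SStar (SAdd a b)) (SAdd (SStar a) (SStar b))
  | scong_starZ c a : scong (SStar (SScale c a)) (SScale c^* (SStar a))
  | scong_starM a b : scong (SStar (SMul a b)) (SMul (SStar b) (SStar a)).

Definition scongb (a b : sexpr) : bool := `[< scong a b >].

Fact scongb_refl : reflexive scongb.
Proof. by move=> a; apply/asboolP; exact: scong_refl. Qed.

Fact scongb_sym : symmetric scongb.
Proof. by move=> a b; apply/asboolP/asboolP => /scong_sym. Qed.

Fact scongb_trans : transitive scongb.
Proof.
by move=> b a d /asboolP ab /asboolP bd; apply/asboolP; apply: scong_trans bd.
Qed.

Canonical scong_equiv := EquivRel scongb scongb_refl scongb_sym scongb_trans.

Definition presented : Type := {eq_quot scong_equiv}.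

HB.instance Definition _ := Choice.on presented.
HB.instance Definition _ := EqQuotient.on presented.

Definition presented_of (a : sexpr) : presented := \pi_presented a.

Lemma presented_ofP a b : presented_of a = presented_of b <-> scong a b.
Proof. by split=> [/eqmodP/asboolP|ab]//; apply/eqmodP/asboolP. Qed.

Lemma presented_reprK x : presented_of (repr x) = x.
Proof. exact: reprK. Qed.

Lemma repr_presented_of a : scong (repr (presented_of a)) a.
Proof. by apply/presented_ofP; rewrite presented_reprK. Qed.

Definition pzero := presented_of SZero.
Definition pone := presented_of SOne.
Definition padd (x y : presented) := presented_of (SAdd (repr x) (repr y)).
Definition pmul (x y : presented) := presented_of (SMul (repr x) (repr y)).
Definition pscale c (x : presented) := presented_of (SScale c (repr x)).
Definition popp x := pscale (-1) x.
Definition pstar (x : presented) := presented_of (SStar (repr x)).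

Lemma paddE a b :
  padd (presented_of a) (presented_of b) = presented_of (SAdd a b).
Proof. by apply/presented_ofP; apply: scong_add; exact: repr_presented_of. Qed.

Lemma pmulE a b :
  pmul (presented_of a) (presented_of b) = presented_of (SMul a b).
Proof. by apply/presented_ofP; apply: scong_mul; exact: repr_presented_of. Qed.

Lemma pscaleE c a : pscale c (presented_of a) = presented_of (SScale c a).
Proof. by apply/presented_ofP; apply: scong_scale; exact: repr_presented_of. Qed.

Lemma pstarE a : pstar (presented_of a) = presented_of (SStar a).
Proof. by apply/presented_ofP; apply: scong_star; exact: repr_presented_of. Qed.

Let pE := (paddE, pmulE, pscaleE, pstarE).

Lemma presented_ind (P : presented -> Prop) :
  (forall a, P (presented_of a)) -> forall x, P x.
Proof. by move=> Pof x; rewrite -(presented_reprK x). Qed.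

Fact paddA : associative padd.
Proof.
elim/presented_ind=> a; elim/presented_ind=> b; elim/presented_ind=> d.
by rewrite !pE; apply/presented_ofP; exact: scong_addA.
Qed.

Fact paddC : commutative padd.
Proof.
elim/presented_ind=> a; elim/presented_ind=> b.
by rewrite !pE; apply/presented_ofP; exact: scong_addC.
Qed.

Fact padd0 : left_id pzero padd.
Proof.
by elim/presented_ind=> a; rewrite !pE; apply/presented_ofP; exact: scong_add0.
Qed.

Fact paddN : left_inverse pzero popp padd.
Proof.
elim/presented_ind=> a.
by rewrite /popp !pE; apply/presented_ofP; exact: scong_addN.
Qed.

HB.instance Definition _ :=
  GRing.isZmodule.Build presented paddA paddC padd0 paddN.

Fact pscaleA c d x : pscale c (pscale d x) = pscale (c * d) x.
Proof.
elim/presented_ind: x => a.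
by rewrite !pE; apply/presented_ofP; exact: scong_scaleA.
Qed.

Fact pscale1 : left_id 1 pscale.
Proof.
elim/presented_ind=> a.
by rewrite !pE; apply/presented_ofP; exact: scong_scale1.
Qed.

Fact pscaleDr : right_distributive pscale +%R.
Proof.
move=> c; elim/presented_ind=> a; elim/presented_ind=> b.
rewrite -[_ + _]/(padd _ _) -[RHS]/(padd _ _) !pE.
by apply/presented_ofP; exact: scong_scaleDr.
Qed.

Fact pscaleDl x : {morph pscale^~ x : c d / c + d}.
Proof.
move=> c d; elim/presented_ind: x => a.
rewrite -[RHS]/(padd _ _) !pE.
by apply/presented_ofP; exact: scong_scaleDl.
Qed.

HB.instance Definition _ := GRing.Zmodule_isLmodule.Build C presented
  pscaleA pscale1 pscaleDr pscaleDl.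

Fact pmulA : associative pmul.
Proof.
elim/presented_ind=> a; elim/presented_ind=> b; elim/presented_ind=> d.
by rewrite !pE; apply/presented_ofP; exact: scong_mulA.
Qed.

Fact pmul1l : left_id pone pmul.
Proof.
by elim/presented_ind=> a; rewrite !pE; apply/presented_ofP; exact: scong_mul1l.
Qed.

Fact pmul1r : right_id pone pmul.
Proof.
by elim/presented_ind=> a; rewrite !pE; apply/presented_ofP; exact: scong_mul1r.
Qed.

Fact pmulDl : left_distributive pmul +%R.
Proof.
elim/presented_ind=> a; elim/presented_ind=> b; elim/presented_ind=> d.
rewrite -[_ + _]/(padd _ _) -[RHS]/(padd _ _) !pE.
by apply/presented_ofP; exact: scong_mulDl.
Qed.

Fact pmulDr : right_distributive pmul +%R.
Proof.
elim/presented_ind=> a; elim/presented_ind=> b; elim/presented_ind=> d.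
rewrite -[_ + _]/(padd _ _) -[RHS]/(padd _ _) !pE.
by apply/presented_ofP; exact: scong_mulDr.
Qed.

HB.instance Definition _ := GRing.Zmodule_isPzRing.Build presented
  pmulA pmul1l pmul1r pmulDl pmulDr.

Fact pscaleAl (c : C) (x y : presented) : c *: (x * y) = (c *: x) * y.
Proof.
elim/presented_ind: x => a; elim/presented_ind: y => b.
rewrite -[LHS]/(pscale _ (pmul _ _)) -[RHS]/(pmul (pscale _ _) _) !pE.
by apply/presented_ofP; exact: scong_scaleAl.
Qed.

Fact pscaleAr (c : C) (x y : presented) : c *: (x * y) = x * (c *: y).
Proof.
elim/presented_ind: x => a; elim/presented_ind: y => b.
rewrite -[LHS]/(pscale _ (pmul _ _)) -[RHS]/(pmul _ (pscale _ _)) !pE.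
by apply/presented_ofP; exact: scong_scaleAr.
Qed.

Fact pstarK : involutive pstar.
Proof.
by elim/presented_ind=> a; rewrite !pE; apply/presented_ofP; exact: scong_starK.
Qed.

Fact pstarD (x y : presented) : pstar (x + y) = pstar x + pstar y.
Proof.
elim/presented_ind: x => a; elim/presented_ind: y => b.
rewrite -[_ + _]/(padd _ _) -[RHS]/(padd _ _) !pE.
by apply/presented_ofP; exact: scong_starD.
Qed.

Fact pstarZ (c : C) (x : presented) : pstar (c *: x) = c^* *: pstar x.
Proof.
elim/presented_ind: x => a.
rewrite -[_ *: _]/(pscale _ _) -[RHS]/(pscale _ _) !pE.
by apply/presented_ofP; exact: scong_starZ.
Qed.

Fact pstarM (x y : presented) : pstar (x * y) = pstar y * pstar x.
Proof.
elim/presented_ind: x => a; elim/presented_ind: y => b.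
rewrite -[_ * _]/(pmul _ _) -[RHS]/(pmul _ _) !pE.
by apply/presented_ofP; exact: scong_starM.
Qed.

Definition presented_gen (g : G) : presented := presented_of (SGen g).

Section Eval.
Variables (A : starAlgType C) (f : G -> A).

Fixpoint sexpr_eval (a : sexpr) : A :=
  match a with
  | SGen g => f g
  | SZero => 0
  | SOne => 1
  | SAdd a b => sexpr_eval a + sexpr_eval b
  | SMul a b => sexpr_eval a * sexpr_eval b
  | SScale c a => c *: sexpr_eval a
  | SStar a => star (sexpr_eval a)
  end.

Lemma sexpr_eval_cong :
  (forall a b, rel a b -> sexpr_eval a = sexpr_eval b) ->
  forall a b, scong a b -> sexpr_eval a = sexpr_eval b.
Proof.
move=> relP a b; elim=> {a b} //=.
- by move=> b a d _ -> _ ->.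
- by move=> a a' b b' _ -> _ ->.
- by move=> a a' b b' _ -> _ ->.
- by move=> c a a' _ ->.
- by move=> a a' _ ->.
- by move=> a b d; rewrite addrA.
- by move=> a b; rewrite addrC.
- by move=> a; rewrite add0r.
- by move=> a; rewrite scaleN1r addNr.
- by move=> c d a; rewrite scalerA.
- by move=> a; rewrite scale1r.
- by move=> c a b; rewrite scalerDr.
- by move=> c d a; rewrite scalerDl.
- by move=> a b d; rewrite mulrA.
- by move=> a; rewrite mul1r.
- by move=> a; rewrite mulr1.
- by move=> a b d; rewrite mulrDl.
- by move=> a b d; rewrite mulrDr.
- by move=> c a b; rewrite scalerAl.
- by move=> c a b; rewrite scalerAr.
- by move=> a; rewrite starK.
- by move=> a b; rewrite starD.
- by move=> c a; rewrite starZ.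
- by move=> a b; rewrite starM.
Qed.

End Eval.

End Presentation.

Arguments SZero {C G}.
Arguments SOne {C G}.
Arguments SGen {C G}.

(******************************************************************************)
(*            Tensor products of modules over a commutative ring              *)
(*                                                                            *)
(* Formal linear combinations of pure tensors, modulo the smallest congruence *)
(* that contains the module axioms and bilinearity.                           *)
(******************************************************************************)

Section Tensor.
Variables (K : comPzRingType) (U V : lmodType K).

Inductive texpr : Type :=
  | TPure of U & V
  | TZero
  | TAdd of texpr & texpr
  | TScale of K & texpr.

HB.instance Definition _ := gen_eqMixin texpr.
HB.instance Definition _ := gen_choiceMixin texpr.

Inductive tcong : texpr -> texpr -> Prop :=
  | tcong_refl s : tcong s s
  | tcong_sym s t : tcong s t -> tcong t s
  | tcong_trans t s r : tcong s t -> tcong t r -> tcong s r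
  | tcong_add s s' t t' :
      tcong s s' -> tcong t t' -> tcong (TAdd s t) (TAdd s' t')
  | tcong_scale c s s' : tcong s s' -> tcong (TScale c s) (TScale c s')
  | tcong_addA s t r : tcong (TAdd s (TAdd t r)) (TAdd (TAdd s t) r)
  | tcong_addC s t : tcong (TAdd s t) (TAdd t s)
  | tcong_add0 s : tcong (TAdd TZero s) s
  | tcong_addN s : tcong (TAdd (TScale (-1) s) s) TZero
  | tcong_scaleA c d s : tcong (TScale c (TScale d s)) (TScale (c * d) s)
  | tcong_scale1 s : tcong (TScale 1 s) s
  | tcong_scaleDr c s t :
      tcong (TScale c (TAdd s t)) (TAdd (TScale c s) (TScale c t))
  | tcong_scaleDl c d s :
      tcong (TScale (c + d) s) (TAdd (TScale c s) (TScale d s))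
  | tcong_pureDl u u' v :
      tcong (TPure (u + u') v) (TAdd (TPure u v) (TPure u' v))
  | tcong_pureDr u v v' :
      tcong (TPure u (v + v')) (TAdd (TPure u v) (TPure u v'))
  | tcong_pureZl c u v : tcong (TPure (c *: u) v) (TScale c (TPure u v))
  | tcong_pureZr c u v : tcong (TPure u (c *: v)) (TScale c (TPure u v)).

Definition tcongb (s t : texpr) : bool := `[< tcong s t >].

Fact tcongb_refl : reflexive tcongb.
Proof. by move=> s; apply/asboolP; exact: tcong_refl. Qed.

Fact tcongb_sym : symmetric tcongb.
Proof. by move=> s t; apply/asboolP/asboolP => /tcong_sym. Qed.

Fact tcongb_trans : transitive tcongb.
Proof.
by move=> t s r /asboolP st /asboolP tr; apply/asboolP; apply: tcong_trans tr.
Qed.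

Canonical tcong_equiv := EquivRel tcongb tcongb_refl tcongb_sym tcongb_trans.

Definition tensor : Type := {eq_quot tcong_equiv}.

HB.instance Definition _ := Choice.on tensor.
HB.instance Definition _ := EqQuotient.on tensor.

Definition tensor_of (s : texpr) : tensor := \pi_tensor s.

Definition tens (u : U) (v : V) : tensor := tensor_of (TPure u v).

Lemma tensor_ofP s t : tensor_of s = tensor_of t <-> tcong s t.
Proof. by split=> [/eqmodP/asboolP|st]//; apply/eqmodP/asboolP. Qed.

Lemma tensor_reprK x : tensor_of (repr x) = x.
Proof. exact: reprK. Qed.

Lemma repr_tensor_of s : tcong (repr (tensor_of s)) s.
Proof. by apply/tensor_ofP; rewrite tensor_reprK. Qed.

Definition tzero := tensor_of TZero.
Definition tadd (x y : tensor) := tensor_of (TAdd (repr x) (repr y)).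
Definition tscale c (x : tensor) := tensor_of (TScale c (repr x)).
Definition topp x := tscale (-1) x.

Lemma taddE s t : tadd (tensor_of s) (tensor_of t) = tensor_of (TAdd s t).
Proof. by apply/tensor_ofP; apply: tcong_add; exact: repr_tensor_of. Qed.

Lemma tscaleE c s : tscale c (tensor_of s) = tensor_of (TScale c s).
Proof. by apply/tensor_ofP; apply: tcong_scale; exact: repr_tensor_of. Qed.

Let tE := (taddE, tscaleE).

Lemma tensor_of_ind (P : tensor -> Prop) :
  (forall s, P (tensor_of s)) -> forall x, P x.
Proof. by move=> Pof x; rewrite -(tensor_reprK x). Qed.

Fact taddA : associative tadd.
Proof.
elim/tensor_of_ind=> s; elim/tensor_of_ind=> t; elim/tensor_of_ind=> r.
by rewrite !tE; apply/tensor_ofP; exact: tcong_addA.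
Qed.

Fact taddC : commutative tadd.
Proof.
elim/tensor_of_ind=> s; elim/tensor_of_ind=> t.
by rewrite !tE; apply/tensor_ofP; exact: tcong_addC.
Qed.

Fact tadd0 : left_id tzero tadd.
Proof.
by elim/tensor_of_ind=> s; rewrite !tE; apply/tensor_ofP; exact: tcong_add0.
Qed.

Fact taddN : left_inverse tzero topp tadd.
Proof.
elim/tensor_of_ind=> s.
by rewrite /topp !tE; apply/tensor_ofP; exact: tcong_addN.
Qed.

HB.instance Definition _ := GRing.isZmodule.Build tensor taddA taddC tadd0 taddN.

Fact tscaleA c d x : tscale c (tscale d x) = tscale (c * d) x.
Proof.
elim/tensor_of_ind: x => s.
by rewrite !tE; apply/tensor_ofP; exact: tcong_scaleA.
Qed.

Fact tscale1 : left_id 1 tscale.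
Proof.
by elim/tensor_of_ind=> s; rewrite !tE; apply/tensor_ofP; exact: tcong_scale1.
Qed.

Fact tscaleDr : right_distributive tscale +%R.
Proof.
move=> c; elim/tensor_of_ind=> s; elim/tensor_of_ind=> t.
rewrite -[_ + _]/(tadd _ _) -[RHS]/(tadd _ _) !tE.
by apply/tensor_ofP; exact: tcong_scaleDr.
Qed.

Fact tscaleDl x : {morph tscale^~ x : c d / c + d}.
Proof.
move=> c d; elim/tensor_of_ind: x => s.
rewrite -[RHS]/(tadd _ _) !tE.
by apply/tensor_ofP; exact: tcong_scaleDl.
Qed.

HB.instance Definition _ := GRing.Zmodule_isLmodule.Build K tensor
  tscaleA tscale1 tscaleDr tscaleDl.

Lemma tensDl u u' v : tens (u + u') v = tens u v + tens u' v.
Proof.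
by rewrite -[RHS]/(tadd _ _) tE; apply/tensor_ofP; exact: tcong_pureDl.
Qed.

Lemma tensDr u v v' : tens u (v + v') = tens u v + tens u v'.
Proof.
by rewrite -[RHS]/(tadd _ _) tE; apply/tensor_ofP; exact: tcong_pureDr.
Qed.

Lemma tensZl c u v : tens (c *: u) v = c *: tens u v.
Proof.
by rewrite -[RHS]/(tscale _ _) tE; apply/tensor_ofP; exact: tcong_pureZl.
Qed.

Lemma tensZr c u v : tens u (c *: v) = c *: tens u v.
Proof.
by rewrite -[RHS]/(tscale _ _) tE; apply/tensor_ofP; exact: tcong_pureZr.
Qed.

Lemma tensor_ind (P : tensor -> Prop) :
  (forall u v, P (tens u v)) -> (forall x y, P x -> P y -> P (x + y)) ->
  (forall c x, P x -> P (c *: x)) -> forall x, P x.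
Proof.
move=> Pt PD PZ; elim/tensor_of_ind; elim=> [u v||s Ps t Pt'|c s Ps].
- exact: Pt.
- by have := PZ 0 _ (Pt 0 0); rewrite scale0r.
- by rewrite -taddE; exact: PD.
- by rewrite -tscaleE; exact: PZ.
Qed.

End Tensor.

Arguments TZero {K U V}.

(* For a map f additive in each argument and homogeneous with respect to the
   scalar endomorphism sigma (sigma = id: bilinear; sigma = conjugation:
   conjugate-bilinear), tensor_lift sigma f is the induced map on tensors; see
   tensor_lift_tens. *)
Section TensorLift.
Variables (K : comPzRingType) (U V W : lmodType K) (sigma : {rmorphism K -> K}).
Variable f : U -> V -> W.

Fixpoint texpr_eval (s : texpr U V) : W :=
  match s with
  | TPure u v => f u v
  | TZero => 0
  | TAdd s t => texpr_eval s + texpr_eval t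
  | TScale c s => sigma c *: texpr_eval s
  end.

Definition tensor_lift (x : tensor U V) : W := texpr_eval (repr x).

Record semibilinear : Prop := SemiBilinear {
  semibilinearDl : forall u u' v, f (u + u') v = f u v + f u' v;
  semibilinearDr : forall u v v', f u (v + v') = f u v + f u v';
  semibilinearZl : forall c u v, f (c *: u) v = sigma c *: f u v;
  semibilinearZr : forall c u v, f u (c *: v) = sigma c *: f u v
}.

Hypothesis fP : semibilinear.

Lemma texpr_eval_cong s t : tcong s t -> texpr_eval s = texpr_eval t.
Proof.
case: fP => fDl fDr fZl fZr; elim=> {s t} //=.
- by move=> t s r _ -> _ ->.
- by move=> s s' t t' _ -> _ ->.
- by move=> c s s' _ ->.
- by move=> s t r; rewrite addrA.
- by move=> s t; rewrite addrC.
- by move=> s; rewrite add0r.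
- by move=> s; rewrite rmorphN1 scaleN1r addNr.
- by move=> c d s; rewrite scalerA rmorphM.
- by move=> s; rewrite rmorph1 scale1r.
- by move=> c s t; rewrite scalerDr.
- by move=> c d s; rewrite rmorphD scalerDl.
Qed.

Lemma tensor_lift_of s : tensor_lift (tensor_of s) = texpr_eval s.
Proof. by apply: texpr_eval_cong; exact: repr_tensor_of. Qed.

Lemma tensor_lift_tens u v : tensor_lift (tens u v) = f u v.
Proof. exact: tensor_lift_of. Qed.

Lemma tensor_liftD x y : tensor_lift (x + y) = tensor_lift x + tensor_lift y.
Proof.
elim/tensor_of_ind: x => s; elim/tensor_of_ind: y => t.
by rewrite -[_ + _]/(tadd _ _) taddE !tensor_lift_of.
Qed.

Lemma tensor_liftZ c x : tensor_lift (c *: x) = sigma c *: tensor_lift x.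
Proof.
elim/tensor_of_ind: x => s.
by rewrite -[_ *: _]/(tscale _ _) tscaleE !tensor_lift_of.
Qed.

End TensorLift.

Definition tensor_blift (K : comPzRingType) (U V W : lmodType K) :=
  @tensor_lift K U V W idfun.

Section TensorMap.
Variables (K : comPzRingType) (U U' V V' : lmodType K).
Variables (f : {linear U -> U'}) (g : {linear V -> V'}).

Definition tensor_map : tensor U V -> tensor U' V' :=
  tensor_blift (fun u v => tens (f u) (g v)).

Fact tensor_map_bilinear :
  semibilinear idfun (fun u v => tens (f u) (g v) : tensor U' V').
Proof.
split=> *; first by rewrite raddfD tensDl.
- by rewrite raddfD tensDr.
- by rewrite linearZ tensZl.
- by rewrite linearZ tensZr.
Qed.

Lemma tensor_map_tens u v : tensor_map (tens u v) = tens (f u) (g v).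
Proof. exact: (tensor_lift_tens tensor_map_bilinear). Qed.

Fact tensor_map_is_linear : linear tensor_map.
Proof.
move=> c x y; rewrite /tensor_map /tensor_blift.
by rewrite (tensor_liftD tensor_map_bilinear) (tensor_liftZ tensor_map_bilinear).
Qed.

HB.instance Definition _ :=
  GRing.isLinear.Build K (tensor U V) (tensor U' V') *:%R tensor_map
    tensor_map_is_linear.

End TensorMap.

Section TensorIso.
Variable K : comPzRingType.

Section Assoc.
Variables U V W : lmodType K.

Definition tensor_assoc : tensor (tensor U V) W -> tensor U (tensor V W) :=
  tensor_blift (fun (x : tensor U V) (w : W) =>
    tensor_blift (fun (u : U) (v : V) => tens u (tens v w)) x :
      tensor U (tensor V W)).

Fact tensor_assoc_bilinear_in w :
  semibilinear idfun
    (fun (u : U) (v : V) => tens u (tens v w) : tensor U (tensor V W)).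
Proof.
split=> *; first by rewrite tensDl.
- by rewrite tensDl tensDr.
- by rewrite tensZl.
- by rewrite tensZl tensZr.
Qed.

Fact tensor_assoc_bilinear :
  semibilinear idfun (fun (x : tensor U V) (w : W) =>
    tensor_blift (fun (u : U) (v : V) => tens u (tens v w)) x :
      tensor U (tensor V W)).
Proof.
rewrite /tensor_blift; have bP := tensor_assoc_bilinear_in.
split=> [x x' w|x w w'|c x w|c x w].
- exact: (tensor_liftD (bP w)).
- elim/tensor_ind: x => [u v|x y IHx IHy|c x IHx].
  + by rewrite !(tensor_lift_tens (bP _)) !tensDr.
  + by rewrite !(tensor_liftD (bP _)) IHx IHy addrACA.
  + by rewrite !(tensor_liftZ (bP _)) IHx scalerDr.
- exact: (tensor_liftZ (bP w)).
- elim/tensor_ind: x => [u v|x y IHx IHy|d x IHx].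
  + by rewrite !(tensor_lift_tens (bP _)) !tensZr.
  + by rewrite !(tensor_liftD (bP _)) IHx IHy scalerDr.
  + by rewrite !(tensor_liftZ (bP _)) IHx /= !scalerA mulrC.
Qed.

Lemma tensor_assoc_tens u v w :
  tensor_assoc (tens (tens u v) w) = tens u (tens v w).
Proof.
rewrite /tensor_assoc /tensor_blift (tensor_lift_tens tensor_assoc_bilinear).
exact: (tensor_lift_tens (tensor_assoc_bilinear_in w)).
Qed.

Fact tensor_assoc_is_linear : linear tensor_assoc.
Proof.
move=> c x y; rewrite /tensor_assoc {1}/tensor_blift.
by rewrite (tensor_liftD tensor_assoc_bilinear)
           (tensor_liftZ tensor_assoc_bilinear).
Qed.

HB.instance Definition _ := GRing.isLinear.Build K
  (tensor (tensor U V) W) (tensor U (tensor V W)) *:%R tensor_assoc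
  tensor_assoc_is_linear.

End Assoc.
End TensorIso.

Section TensorUnit.
Variables (K : comNzRingType) (V : lmodType K).

Definition tensor_lunit : tensor K^o V -> V :=
  tensor_blift (fun (c : K^o) (v : V) => c *: v).

Definition tensor_runit : tensor V K^o -> V :=
  tensor_blift (fun (v : V) (c : K^o) => c *: v).

Fact tensor_lunit_bilinear :
  semibilinear idfun (fun (c : K^o) (v : V) => c *: v).
Proof.
split=> [c d v|c u v|c d v|c d v] /=.
- exact: scalerDl.
- exact: scalerDr.
- by rewrite scalerA.
- by rewrite !scalerA mulrC.
Qed.

Fact tensor_runit_bilinear :
  semibilinear idfun (fun (v : V) (c : K^o) => c *: v).
Proof.
by case: tensor_lunit_bilinear => Dl Dr Zl Zr;
  split=> [u v c|v c d|c v d|c v d]; [exact: Dr|exact: Dl|exact: Zr|exact: Zl].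
Qed.

Lemma tensor_lunit_tens c v : tensor_lunit (tens c v) = c *: v.
Proof. exact: (tensor_lift_tens tensor_lunit_bilinear). Qed.

Lemma tensor_runit_tens v c : tensor_runit (tens v c) = c *: v.
Proof. exact: (tensor_lift_tens tensor_runit_bilinear). Qed.

Fact tensor_lunit_is_linear : linear tensor_lunit.
Proof.
move=> c x y; rewrite /tensor_lunit /tensor_blift.
by rewrite (tensor_liftD tensor_lunit_bilinear)
           (tensor_liftZ tensor_lunit_bilinear).
Qed.

Fact tensor_runit_is_linear : linear tensor_runit.
Proof.
move=> c x y; rewrite /tensor_runit /tensor_blift.
by rewrite (tensor_liftD tensor_runit_bilinear)
           (tensor_liftZ tensor_runit_bilinear).
Qed.

HB.instance Definition _ := GRing.isLinear.Build K
  (tensor K^o V) V *:%R tensor_lunit tensor_lunit_is_linear.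
HB.instance Definition _ := GRing.isLinear.Build K
  (tensor V K^o) V *:%R tensor_runit tensor_runit_is_linear.

End TensorUnit.

Section TensorNonzero.
Variable K : fieldType.

Lemma exists_linear_form (V : lmodType K) (v : V) :
  v != 0 -> exists2 phi : V -> K^o, linear phi & phi v = 1.
Proof.
move=> v0.
pose P (S : set V) := (forall (c : K) x y, S x -> S y -> S (c *: x + y)) /\ ~ S v.
have [F FP Ftot|M [[Mlin Mv] Mmax]] := @Zorn_bigcup V P.
  split=> [c x y [X FX Xx] [Y FY Yy]|[X FX Xv]]; last by case: (FP _ FX).
  have [XY|YX] := Ftot _ _ FX FY.
  - by exists Y => //; apply: (FP _ FY).1 => //; exact: XY.
  - by exists X => //; apply: (FP _ FX).1 => //; exact: YX.
have M0 : M 0.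
  apply: contrapT => nM0; apply: (Mmax (M `|` [set 0])%classic).
    by split=> [x Mx|/(_ 0)]; [left|move=> h; apply: nM0; apply: h; right].
  split=> [c x y|[//|/= v00]]; last by rewrite v00 eqxx in v0.
  move=> [Mx|->] [My|->].
  - by left; exact: Mlin.
  - case: (pselect (M (c *: x + 0))) => [|nM]; first by left.
    have Mx2 : M (-1 *: x + x) by exact: Mlin.
    by rewrite scaleN1r addNr in Mx2.
  - by left; rewrite scaler0 add0r.
  - by right; rewrite /= scaler0 addr0.
have MZ c x : M x -> M (c *: x) by move=> Mx; rewrite -[_ *: _]addr0; exact: Mlin.
have MD x y : M x -> M y -> M (x + y).
  by move=> Mx My; rewrite -[x]scale1r; exact: Mlin.
have ex a : exists c : K, M (a - c *: v).
  apply: contrapT => na.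
  apply: (Mmax [set x | exists c : K, M (x - c *: a)]%classic).
    split=> [x Mx /=|/(_ a)/=]; first by exists 0; rewrite scale0r subr0.
    move=> h; apply: na; exists 0; rewrite scale0r subr0; apply: h.
    by exists 1; rewrite scale1r subrr.
  split=> [c x y /= [d Mx] [e My]|/= [c Mc]].
    exists (c * d + e); have := Mlin c _ _ Mx My.
    by rewrite scalerBr scalerA addrACA -opprD scalerDl.
  have [c0|c0] := eqVneq c 0.
    by apply: Mv; rewrite c0 scale0r subr0 in Mc.
  apply: na; exists c^-1; have := MZ (- c^-1) _ Mc.
  by rewrite scalerBr scalerA mulNr mulVf // !scaleNr scale1r opprK addrC.
have uniq a c d : M (a - c *: v) -> M (a - d *: v) -> c = d.
  move=> Mc Md; apply/eqP; rewrite -subr_eq0; apply/negPn/negP => cd.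
  apply: Mv; have := MZ (c - d)^-1 _ (Mlin (-1) _ _ Mc Md).
  by rewrite scaleN1r opprB addrA subrK -scalerBl scalerA mulVf // scale1r.
have [phi phiP] := choice ex.
exists phi.
- move=> c x y; apply: (uniq (c *: x + y)); first exact: phiP.
  rewrite scalerDl opprD addrACA -scalerA -scalerBr.
  exact: Mlin.
- by apply: (uniq v); [exact: phiP|rewrite scale1r subrr].
Qed.

Lemma tens_neq0 (U V : lmodType K) (u : U) (v : V) :
  u != 0 -> v != 0 -> tens u v != 0.
Proof.
move=> /exists_linear_form[f flin fu] /exists_linear_form[g glin gv].
pose fL := GRing.isLinear.Build K U K^o *:%R f flin.
pose gL := GRing.isLinear.Build K V K^o *:%R g glin.
pose f' : {linear U -> K^o} := HB.pack f fL.
pose g' : {linear V -> K^o} := HB.pack g gL.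
apply/eqP => uv0.
have := raddf0 (@tensor_lunit K K^o \o tensor_map f' g').
rewrite /= -uv0 tensor_map_tens tensor_lunit_tens /= fu gv scale1r => /eqP.
by rewrite oner_eq0.
Qed.

End TensorNonzero.

(* The star-algebra structure of A (x) B:
   (a (x) b) (a' (x) b') = aa' (x) bb' and (a (x) b)^* = a^* (x) b^*; see
   tensM and star_tens. *)
Section TensorStarAlgebra.
Variables (C : numClosedFieldType) (A B : starAlgType C).
Local Notation AB := (tensor A B).

Definition tmul (x y : AB) : AB :=
  tensor_blift (fun (a : A) (b : B) =>
    tensor_blift (fun (a' : A) (b' : B) => tens (a * a') (b * b')) y) x.

Definition tone : AB := tens 1 1.

Definition tstar : AB -> AB :=
  tensor_lift Num.conj (fun (a : A) (b : B) => tens (star a) (star b)).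

Fact tmul_bilinear_in a b :
  semibilinear idfun (fun (a' : A) (b' : B) => tens (a * a') (b * b')).
Proof.
split=> *; first by rewrite mulrDr tensDl.
- by rewrite mulrDr tensDr.
- by rewrite -scalerAr tensZl.
- by rewrite -scalerAr tensZr.
Qed.

Fact tmul_bilinear y :
  semibilinear idfun (fun (a : A) (b : B) =>
    tensor_blift (fun (a' : A) (b' : B) => tens (a * a') (b * b')) y : AB).
Proof.
rewrite /tensor_blift; have bP := tmul_bilinear_in.
split=> [a a0 b|a b b0|c a b|c a b]; elim/tensor_ind: y => [a' b'|x y IHx IHy|d x IHx].
all: rewrite ?(tensor_lift_tens (bP _ _)) ?(tensor_liftD (bP _ _))
             ?(tensor_liftZ (bP _ _)) ?IHx ?IHy ?scalerDr //=.
- by rewrite mulrDl tensDl.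
- by rewrite addrACA.
- by rewrite mulrDl tensDr.
- by rewrite addrACA.
- by rewrite -scalerAl tensZl.
- by rewrite !scalerA mulrC.
- by rewrite -scalerAl tensZr.
- by rewrite !scalerA mulrC.
Qed.

Fact tmul_tens a b a' b' :
  tmul (tens a b) (tens a' b') = tens (a * a') (b * b').
Proof.
rewrite /tmul /tensor_blift (tensor_lift_tens (tmul_bilinear _)).
exact: (tensor_lift_tens (tmul_bilinear_in a b)).
Qed.

Fact tmulDl : left_distributive tmul +%R.
Proof. by move=> x y z; exact: (tensor_liftD (tmul_bilinear z)). Qed.

Fact tmulZl c x y : tmul (c *: x) y = c *: tmul x y.
Proof. exact: (tensor_liftZ (tmul_bilinear y)). Qed.

Fact tmulDr : right_distributive tmul +%R.
Proof.
move=> x y z; elim/tensor_ind: x => [a b|x x' IHx IHx'|c x IHx].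
- rewrite /tmul /tensor_blift !(tensor_lift_tens (tmul_bilinear _)).
  exact: (tensor_liftD (tmul_bilinear_in a b)).
- by rewrite !tmulDl IHx IHx' addrACA.
- by rewrite !tmulZl IHx scalerDr.
Qed.

Fact tmulZr c x y : tmul x (c *: y) = c *: tmul x y.
Proof.
elim/tensor_ind: x => [a b|x x' IHx IHx'|d x IHx].
- rewrite /tmul /tensor_blift !(tensor_lift_tens (tmul_bilinear _)).
  exact: (tensor_liftZ (tmul_bilinear_in a b)).
- by rewrite !tmulDl IHx IHx' scalerDr.
- by rewrite !tmulZl IHx !scalerA mulrC.
Qed.

Fact tmulA : associative tmul.
Proof.
move=> x y z; elim/tensor_ind: x => [a b|x x' IHx IHx'|c x IHx].
- elim/tensor_ind: y => [a' b'|y y' IHy IHy'|c y IHy].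
  + elim/tensor_ind: z => [a2 b2|z z' IHz IHz'|c z IHz].
    * by rewrite !tmul_tens !mulrA.
    * by rewrite !tmulDr IHz IHz'.
    * by rewrite !tmulZr IHz.
  + by rewrite tmulDl !tmulDr IHy IHy' tmulDl.
  + by rewrite tmulZl !tmulZr IHy tmulZl.
- by rewrite !tmulDl IHx IHx'.
- by rewrite !tmulZl IHx.
Qed.

Fact tmul1l : left_id tone tmul.
Proof.
elim/tensor_ind=> [a b|x y IHx IHy|c x IHx].
- by rewrite tmul_tens !mul1r.
- by rewrite tmulDr IHx IHy.
- by rewrite tmulZr IHx.
Qed.

Fact tmul1r : right_id tone tmul.
Proof.
elim/tensor_ind=> [a b|x y IHx IHy|c x IHx].
- by rewrite tmul_tens !mulr1.
- by rewrite tmulDl IHx IHy.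
- by rewrite tmulZl IHx.
Qed.

Fact tone_neq0 : tone != 0.
Proof. by apply: tens_neq0; exact: oner_neq0. Qed.

HB.instance Definition _ := GRing.Zmodule_isNzRing.Build AB
  tmulA tmul1l tmul1r tmulDl tmulDr tone_neq0.

Fact tstar_semibilinear :
  semibilinear Num.conj (fun (a : A) (b : B) => tens (star a) (star b) : AB).
Proof.
split=> *; first by rewrite starD tensDl.
- by rewrite starD tensDr.
- by rewrite starZ tensZl.
- by rewrite starZ tensZr.
Qed.

Fact tstar_tens a b : tstar (tens a b) = tens (star a) (star b).
Proof. exact: (tensor_lift_tens tstar_semibilinear). Qed.

Fact tstarD (x y : AB) : tstar (x + y) = tstar x + tstar y.
Proof. exact: (tensor_liftD tstar_semibilinear). Qed.

Fact tstarZ (c : C) (x : AB) : tstar (c *: x) = c^* *: tstar x.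
Proof. exact: (tensor_liftZ tstar_semibilinear). Qed.

Fact tstarK : involutive tstar.
Proof.
elim/tensor_ind=> [a b|x y IHx IHy|c x IHx].
- by rewrite !tstar_tens !starK.
- by rewrite !tstarD IHx IHy.
- by rewrite !tstarZ IHx conjCK.
Qed.

Fact tstarM (x y : AB) : tstar (x * y) = tstar y * tstar x.
Proof.
rewrite -[x * y]/(tmul x y) -[RHS]/(tmul _ _).
elim/tensor_ind: x => [a b|x x' IHx IHx'|c x IHx].
- elim/tensor_ind: y => [a' b'|y y' IHy IHy'|c y IHy].
  + by rewrite tmul_tens !tstar_tens tmul_tens !starM.
  + by rewrite tmulDr !tstarD IHy IHy' tmulDl.
  + by rewrite tmulZr !tstarZ IHy tmulZl.
- by rewrite tmulDl !tstarD IHx IHx' tmulDr.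
- by rewrite tmulZl !tstarZ IHx tmulZr.
Qed.

Fact tscaleAl (c : C) (x y : AB) : c *: (x * y) = (c *: x) * y.
Proof. by rewrite -[RHS]/(tmul _ _) tmulZl. Qed.

Fact tscaleAr (c : C) (x y : AB) : c *: (x * y) = x * (c *: y).
Proof. by rewrite -[RHS]/(tmul _ _) tmulZr. Qed.

HB.instance Definition _ := GRing.Lmodule_isLalgebra.Build C AB tscaleAl.
HB.instance Definition _ := GRing.Lalgebra_isAlgebra.Build C AB tscaleAr.
HB.instance Definition _ := isStarAlgebra.Build C AB
  tstarK tstarD tstarZ tstarM.

Lemma tens11 : tens 1 1 = 1 :> AB.
Proof. by []. Qed.

Lemma tensM a b a' b' : (tens a b : AB) * tens a' b' = tens (a * a') (b * b').
Proof. exact: tmul_tens. Qed.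

Lemma star_tens a b : star (tens a b : AB) = tens (star a) (star b).
Proof. exact: tstar_tens. Qed.

End TensorStarAlgebra.

(* A coproduct and a counit that are unital star-homomorphisms by their types. *)
Record is_star_bialgebra (C : numClosedFieldType) (A : starAlgType C)
    (Delta : starHom A (tensor A A)) (eps : starHom A C^o) : Prop := {
  coassociative : forall a : A,
    tensor_assoc (tensor_map Delta idfun (Delta a)) =
    tensor_map idfun Delta (Delta a);
  counital_left : forall a : A,
    tensor_lunit (tensor_map eps idfun (Delta a)) = a;
  counital_right : forall a : A,
    tensor_runit (tensor_map idfun eps (Delta a)) = a
}.

(******************************************************************************)
(*                        The star-algebra hatB                               *)
(******************************************************************************)

Definition posnat : Type := {k : nat | (0 < k)%N}.

Inductive hatB_gen : Type :=
  | GenX of posnat & set posnat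
  | GenP of set posnat.

Section HatB.
Variable C : numClosedFieldType.

Local Notation EX k s := (SGen (GenX k s)).
Local Notation EP s := (SGen (GenP s)).

Inductive hatB_rel : sexpr C hatB_gen -> sexpr C hatB_gen -> Prop :=
  | hatB_star_X k s : hatB_rel (SStar (EX k s)) (EX k s)
  | hatB_star_P s : hatB_rel (SStar (EP s)) (EP s)
  | hatB_PP s t : hatB_rel (SMul (EP s) (EP t)) (EP (s `&` t)%classic)
  | hatB_PT : hatB_rel (EP setT) SOne
  | hatB_PX k s t : s k -> hatB_rel (SMul (EP s) (EX k t)) (SMul (EX k t) (EP s)).

Definition hatB : Type := presented hatB_rel.

HB.instance Definition _ := GRing.PzRing.on hatB.
HB.instance Definition _ := GRing.Lmodule.on hatB.

Fact hatB_oner_neq0 : (1 : hatB) != 0.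
Proof.
apply/eqP => /presented_ofP.
pose f (g : hatB_gen) : C^o := if g is GenP _ then 1 else 0.
have star01 : star (0 : C^o) = 0 /\ star (1 : C^o) = 1.
  by split; [exact: rmorph0 | exact: rmorph1].
move=> /(@sexpr_eval_cong _ _ _ _ f) /= f10.
suff /f10/eqP : forall a b, hatB_rel a b -> sexpr_eval f a = sexpr_eval f b.
  by rewrite oner_eq0.
move=> a b [k s|s|s t||k s t _] //=; rewrite ?mulr1 ?mul0r ?mulr0 //.
- exact: (proj1 star01).
- exact: (proj2 star01).
Qed.

HB.instance Definition _ :=
  GRing.PzSemiRing_isNonZero.Build hatB hatB_oner_neq0.
HB.instance Definition _ :=
  GRing.Lmodule_isLalgebra.Build C hatB (@pscaleAl C hatB_gen hatB_rel).
HB.instance Definition _ :=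
  GRing.Lalgebra_isAlgebra.Build C hatB (@pscaleAr C hatB_gen hatB_rel).
HB.instance Definition _ := isStarAlgebra.Build C hatB
  (@pstarK C hatB_gen hatB_rel) (@pstarD C hatB_gen hatB_rel)
  (@pstarZ C hatB_gen hatB_rel) (@pstarM C hatB_gen hatB_rel).

Definition hatX (k : posnat) (s : set posnat) : hatB :=
  presented_gen hatB_rel (GenX k s).

Definition hatP (s : set posnat) : hatB := presented_gen hatB_rel (GenP s).

Definition is_hat_coproduct (Delta : starHom hatB (tensor hatB hatB)) : Prop :=
  (forall k s, Delta (hatX k s) =
     tens (hatX k s) (hatP s) + tens (hatP s) (hatX k s)) /\
  (forall s, Delta (hatP s) = tens (hatP s) (hatP s)).

Definition is_hat_counit (eps : starHom hatB C^o) : Prop :=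
  (forall k s, eps (hatX k s) = 0) /\ (forall s, eps (hatP s) = 1).

End HatB.

Arguments hatX {C}.
Arguments hatP {C}.

(* Main.v *)
Require Import Defs.
From HB Require Import structures.
From mathcomp Require Import all_boot all_order all_algebra.
From mathcomp Require Import classical_sets.
From mathcomp Require Import reals complex.

(** The algebra [hatB] is presented by generators and relations, so a unital
    star-homomorphism out of it is the same thing as a choice of images of the
    generators that satisfies the relations ([hatB_universal] for existence,
    [hatB_hom_eq] for uniqueness).  This reduces everything to generators.

    The coproduct exists because the elements
    [X_k(s) (x) P(s) + P(s) (x) X_k(s)] and [P(s) (x) P(s)] satisfy the
    relations of [hatB] ([coproduct_gen_rel]).  The one relation that takes an
    argument is the commutation of [P(s)] with [X_k(t)] for [k] in [s]: in each
    summand of the product, one leg commutes by the very same relation and the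
    other leg because the projections commute with each other,
    [P(s) P(t)] and [P(t) P(s)] both being the projection of the intersection.
    The counit exists because sending every [X_k(s)] to 0 and every [P(s)] to 1
    obviously satisfies the relations.

    Each of the bialgebra axioms is an equality between two linear maps on
    [hatB] that are both multiplicative: tensor products of homomorphisms, the
    associator and the unitors are homomorphisms of algebras, which needs
    checking on pure tensors only ([tensor_multiplicative]).  So the axioms,
    too, hold as soon as they hold on generators.  There, both sides of
    coassociativity for [X_k(s)] are
    [X (x) P (x) P + P (x) X (x) P + P (x) P (x) X], and applying the counit to
    one leg of [X (x) P + P (x) X] leaves [X]. *)

Set Implicit Arguments.
Unset Strict Implicit.
Unset Printing Implicit Defensive.

Import GRing.Theory.

Local Open Scope ring_scope.
Local Open Scope complex_scope.

(** * Algebra homomorphisms between tensor products *)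

Section TensorHom.
Variable C : numClosedFieldType.

Lemma tensor_multiplicative (A B : starAlgType C) (D : algType C)
    (h : {linear tensor A B -> D}) :
  (forall a b a' b',
     h (tens (a * a') (b * b')) = h (tens a b) * h (tens a' b')) ->
  {morph h : x y / x * y}.
Proof.
move=> hM x y; elim/tensor_ind: x => [a b|x x' IHx IHx'|c x IHx].
- elim/tensor_ind: y => [a' b'|y y' IHy IHy'|c y IHy].
  + by rewrite tensM hM.
  + by rewrite mulrDr !raddfD /= IHy IHy' mulrDr.
  + by rewrite -scalerAr !linearZ /= IHy scalerAr.
- by rewrite mulrDl !raddfD /= IHx IHx' mulrDl.
- by rewrite -scalerAl !linearZ /= IHx scalerAl.
Qed.

Section Map.
Variables (A A' B B' : starAlgType C).
Variables (f : {lrmorphism A -> A'}) (g : {lrmorphism B -> B'}).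

Fact tensor_map_monoid_morphism : monoid_morphism (tensor_map f g).
Proof.
split; first by rewrite -tens11 tensor_map_tens !rmorph1.
apply: tensor_multiplicative => a b a' b'.
by rewrite /= !tensor_map_tens !rmorphM tensM.
Qed.

HB.instance Definition _ := GRing.isMonoidMorphism.Build
  (tensor A B) (tensor A' B') (tensor_map f g) tensor_map_monoid_morphism.

End Map.

Fact tensor_assoc_monoid_morphism (A B D : starAlgType C) :
  monoid_morphism (@tensor_assoc C A B D).
Proof.
split; first by rewrite -!tens11 tensor_assoc_tens.
apply: tensor_multiplicative => x d x' d' /=.
(* The first leg is itself a tensor: with [d] and [d'] fixed, the claim is
   bilinear in [x] and [x'], so it is enough to have it on pure ones. *)
elim/tensor_ind: x => [a b|x y IHx IHy|c x IHx].
- elim/tensor_ind: x' => [a' b'|x y IHx IHy|c x IHx].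
  + by rewrite tensM !tensor_assoc_tens !tensM.
  + by rewrite mulrDr !tensDl !raddfD /= IHx IHy mulrDr.
  + by rewrite -scalerAr !tensZl !linearZ /= IHx scalerAr.
- by rewrite mulrDl !tensDl !raddfD /= IHx IHy mulrDl.
- by rewrite -scalerAl !tensZl !linearZ /= IHx scalerAl.
Qed.

HB.instance Definition _ (A B D : starAlgType C) :=
  GRing.isMonoidMorphism.Build (tensor (tensor A B) D) (tensor A (tensor B D))
    (@tensor_assoc C A B D) (@tensor_assoc_monoid_morphism A B D).

Section Unitors.
Variable A : starAlgType C.

Fact tensor_lunit_monoid_morphism : monoid_morphism (@tensor_lunit C A).
Proof.
split; first by rewrite -tens11 tensor_lunit_tens scale1r.
apply: tensor_multiplicative => c a c' a'.
by rewrite /= !tensor_lunit_tens -scalerAl -scalerAr scalerA.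
Qed.

Fact tensor_runit_monoid_morphism : monoid_morphism (@tensor_runit C A).
Proof.
split; first by rewrite -tens11 tensor_runit_tens scale1r.
apply: tensor_multiplicative => a c a' c'.
by rewrite /= !tensor_runit_tens -scalerAl -scalerAr scalerA.
Qed.

HB.instance Definition _ := GRing.isMonoidMorphism.Build
  (tensor C^o A) A (@tensor_lunit C A) tensor_lunit_monoid_morphism.
HB.instance Definition _ := GRing.isMonoidMorphism.Build
  (tensor A C^o) A (@tensor_runit C A) tensor_runit_monoid_morphism.

End Unitors.

End TensorHom.

(** * The universal property of the presentation *)

Section Universal.
Variable C : numClosedFieldType.
Local Notation B := (hatB C).
Local Notation cls := (@presented_of C hatB_gen (@hatB_rel C)).

Let clsD a b : cls (SAdd a b) = cls a + cls b :> B.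
Proof. by rewrite -paddE. Qed.
Let clsM a b : cls (SMul a b) = cls a * cls b :> B.
Proof. by rewrite -pmulE. Qed.
Let clsZ c a : cls (SScale c a) = c *: (cls a : B) :> B.
Proof. by rewrite -pscaleE. Qed.
Let clsS a : cls (SStar a) = star (cls a : B) :> B.
Proof. by rewrite -pstarE. Qed.

Section Lift.
Variables (A : starAlgType C) (f : hatB_gen -> A).
Hypothesis f_rel : forall a b, hatB_rel a b -> sexpr_eval f a = sexpr_eval f b.

Let lift (x : B) : A := sexpr_eval f (repr x).

Let liftE a : lift (cls a) = sexpr_eval f a.
Proof. by apply: (sexpr_eval_cong f_rel); exact: repr_presented_of. Qed.

Let lift_linear : linear lift.
Proof.
move=> c; elim/presented_ind=> a; elim/presented_ind=> b.
by rewrite -clsZ -clsD !liftE.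
Qed.

Let lift_monoid_morphism : monoid_morphism lift.
Proof.
split; first exact: liftE.
by elim/presented_ind=> a; elim/presented_ind=> b; rewrite -clsM !liftE.
Qed.

Let lift_star x : lift (star x) = star (lift x).
Proof. by elim/presented_ind: x => a; rewrite -clsS !liftE. Qed.

Lemma hatB_universal :
  exists F : starHom B A, forall g, F (presented_gen (@hatB_rel C) g) = f g.
Proof.
pose FL := GRing.isLinear.Build C B A *:%R lift lift_linear.
pose FM := GRing.isMonoidMorphism.Build B A lift lift_monoid_morphism.
pose FS := isStarPreserving.Build C B A lift lift_star.
pose F : starHom B A := HB.pack lift FL FM FS.
by exists F => g; exact: liftE.
Qed.

End Lift.

(** The generators are self-adjoint, so they generate [hatB] already as an
    algebra, and an algebra homomorphism is determined by its values on them. *)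
Lemma hatB_hom_eq (A : algType C) (F G : {lrmorphism B -> A}) :
  (forall k s, F (hatX k s) = G (hatX k s)) ->
  (forall s, F (hatP s) = G (hatP s)) -> F =1 G.
Proof.
move=> FGX FGP; elim/presented_ind=> a.
(* Adjoints of subexpressions occur, so they are carried along. *)
suff [] : F (cls a) = G (cls a) /\ F (star (cls a : B)) = G (star (cls a : B)).
  by [].
elim: a => [g|||a [IHa IHas] b [IHb IHbs]|a [IHa IHas] b [IHb IHbs]
           |c a [IHa IHas]|a [IHa IHas]].
- have star_gen : star (cls (SGen g) : B) = cls (SGen g).
    rewrite -clsS; apply/presented_ofP; apply: scong_rel.
    by case: g => [k s|s]; constructor.
  rewrite star_gen; case: g {star_gen} => [k s|s]; split;
    first [exact: FGX | exact: FGP].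
- have -> : cls SZero = 0 :> B by [].
  have -> : star (0 : B) = 0.
    by rewrite -[0 in LHS](scale0r 0) starZ rmorph0 scale0r.
  by rewrite !raddf0.
- have star1 : star (1 : B) = 1.
    by rewrite -[LHS]mul1r -{1}[1 : B]starK -starM mul1r starK.
  have -> : cls SOne = 1 :> B by [].
  by rewrite star1 !rmorph1.
- by rewrite clsD starD !raddfD /= IHa IHb IHas IHbs.
- by rewrite clsM starM !rmorphM /= IHa IHb IHas IHbs.
- by rewrite clsZ starZ !linearZ /= IHa IHas.
- by rewrite clsS starK.
Qed.

End Universal.

(** * The bialgebra structure *)

Section Bialgebra.
Variable C : numClosedFieldType.
Local Notation B := (hatB C).

Let presented_rel a b : @hatB_rel C a b ->
  presented_of (@hatB_rel C) a = presented_of (@hatB_rel C) b.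
Proof. by move=> ab; apply/presented_ofP; exact: scong_rel. Qed.

Lemma star_hatX k s : star (hatX k s : B) = hatX k s.
Proof.
by rewrite -[LHS]/(pstar _) pstarE; apply: presented_rel; exact: hatB_star_X.
Qed.

Lemma star_hatP s : star (hatP s : B) = hatP s.
Proof.
by rewrite -[LHS]/(pstar _) pstarE; apply: presented_rel; exact: hatB_star_P.
Qed.

Lemma hatPM s t : (hatP s : B) * hatP t = hatP (s `&` t)%classic.
Proof.
by rewrite -[LHS]/(pmul _ _) pmulE; apply: presented_rel; exact: hatB_PP.
Qed.

Lemma hatPT : hatP setT = 1 :> B.
Proof. by apply: presented_rel; exact: hatB_PT. Qed.

Lemma hatPX k s t : s k -> (hatP s : B) * hatX k t = hatX k t * hatP s.
Proof.
move=> sk; rewrite -[LHS]/(pmul _ _) -[RHS]/(pmul _ _) !pmulE.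
by apply: presented_rel; exact: hatB_PX.
Qed.

Definition coproduct_gen (g : hatB_gen) : tensor B B :=
  match g with
  | GenX k s => tens (hatX k s) (hatP s) + tens (hatP s) (hatX k s)
  | GenP s => tens (hatP s) (hatP s)
  end.

Lemma coproduct_gen_rel a b :
  hatB_rel a b -> sexpr_eval coproduct_gen a = sexpr_eval coproduct_gen b.
Proof.
case=> [k s|s|s t||k s t sk] /=.
- by rewrite starD !star_tens star_hatX star_hatP.
- by rewrite star_tens star_hatP.
- by rewrite tensM hatPM.
- by rewrite hatPT.
- have PC : (hatP s : B) * hatP t = hatP t * hatP s by rewrite !hatPM setIC.
  by rewrite mulrDr mulrDl !tensM PC (hatPX _ sk).
Qed.

Definition counit_gen (g : hatB_gen) : C^o := if g is GenP _ then 1 else 0.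

Lemma counit_gen_rel a b :
  hatB_rel a b -> sexpr_eval counit_gen a = sexpr_eval counit_gen b.
Proof.
case=> [k s|s|s t||k s t _] /=; rewrite ?mulr1 ?mul0r ?mulr0 //.
- exact: rmorph0.
- exact: rmorph1.
Qed.

Lemma hatB_star_bialgebra (Delta : starHom B (tensor B B))
    (eps : starHom B C^o) :
  is_hat_coproduct Delta -> is_hat_counit eps -> is_star_bialgebra Delta eps.
Proof.
move=> [DX DP] [eX eP]; split.
- apply: (hatB_hom_eq
    (F := tensor_assoc (W := B) \o tensor_map Delta idfun \o Delta)
    (G := tensor_map idfun Delta \o Delta)) => [k s|s] /=.
  + rewrite DX !raddfD /= !tensor_map_tens /= DX DP tensDl tensDr.
    by rewrite raddfD /= !tensor_assoc_tens addrA.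
  + by rewrite DP !tensor_map_tens /= DP tensor_assoc_tens.
- apply: (hatB_hom_eq
    (F := tensor_lunit (V := B) \o tensor_map eps idfun \o Delta)
    (G := idfun)) => [k s|s] /=.
  + rewrite DX !raddfD /= !tensor_map_tens /= eX eP !tensor_lunit_tens.
    by rewrite scale0r add0r scale1r.
  + by rewrite DP tensor_map_tens /= eP tensor_lunit_tens scale1r.
- apply: (hatB_hom_eq
    (F := tensor_runit (V := B) \o tensor_map idfun eps \o Delta)
    (G := idfun)) => [k s|s] /=.
  + rewrite DX !raddfD /= !tensor_map_tens /= eX eP !tensor_runit_tens.
    by rewrite scale0r addr0 scale1r.
  + by rewrite DP tensor_map_tens /= eP tensor_runit_tens scale1r.
Qed.

End Bialgebra.

Theorem proposition2p3 (R : realType) :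
  exists (Delta : starHom (hatB R[i]) (tensor (hatB R[i]) (hatB R[i])))
         (eps : starHom (hatB R[i]) (R[i])^o),
    [/\ is_hat_coproduct Delta,
        is_hat_counit eps,
        forall Delta' : starHom (hatB R[i]) (tensor (hatB R[i]) (hatB R[i])),
          is_hat_coproduct Delta' -> Delta' =1 Delta,
        forall eps' : starHom (hatB R[i]) (R[i])^o,
          is_hat_counit eps' -> eps' =1 eps
      & is_star_bialgebra Delta eps].
Proof.
have [Delta DE] := hatB_universal (@coproduct_gen_rel R[i]).
have [eps eE] := hatB_universal (@counit_gen_rel R[i]).
have DeltaP : is_hat_coproduct Delta by split=> *; exact: DE.
have epsP : is_hat_counit eps by split=> *; exact: eE.
exists Delta, eps; split=> //; last exact: hatB_star_bialgebra.
- move=> Delta' [DX DP].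
  by apply: hatB_hom_eq => [k s|s] /=; rewrite ?DX ?DP ?DeltaP.1 ?DeltaP.2.
- move=> eps' [eX eP].
  by apply: hatB_hom_eq => [k s|s] /=; rewrite ?eX ?eP ?epsP.1 ?epsP.2.
Qed.
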